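(* Let $R$ be a commutative Noetherian henselian local ring and let $\mathcal C$ be a resolving subcategory of $\mathrm{mod}\,R$. Suppose that $\mathrm{mod}\,\underline{\mathcal C}$ is a quasi-Frobenius category. Then $\mathcal C\subseteq\mathcal H$.
   Context: $\mathrm{mod}\,R$ is the category of finitely generated $R$-modules. A *subcategory* of $\mathrm{mod}\,R$ always means a full subcategory closed under isomorphism, such that for all $X,Y\in\mathrm{mod}\,R$ one has $X\oplus Y\in\mathcal C$ if and only if $X\in\mathcal C$ and $Y\in\mathcal C$, and which contains all projective modules in $\mathrm{mod}\,R$. $\mathcal C$ is *resolving* if for every exact sequence $0\to X\to Y\to Z\to 0$ in $\mathrm{mod}\,R$: $X,Z\in\mathcal C$ implies $Y\in\mathcal C$, and $Y,Z\in\mathcal C$ implies $X\in\mathcal C$. $\mathcal H$ is the subcategory of all $X\in\mathrm{mod}\,R$ with $\mathrm{Ext}^i_R(X,R)=0$ for all $i>0$. The stable category $\underline{\mathcal C}$ has the same objects as $\mathcal C$, and its morphism sets are $\underline{\mathrm{Hom}}_R(X,Y)=\mathrm{Hom}_R(X,Y)/P(X,Y)$, where $P(X,Y)$ is the submodule of homomorphisms that factor through projective modules. $\mathrm{mod}\,\underline{\mathcal C}$ is the category of finitely presented contravariant additive functors $F$ from $\underline{\mathcal C}$ to abelian groups, with natural transformations as morphisms; finitely presented means that there is an exact sequence $\underline{\mathrm{Hom}}_R(-,X_1)|_{\underline{\mathcal C}}\to\underline{\mathrm{Hom}}_R(-,X_0)|_{\underline{\mathcal C}}\to F\to 0$ with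 $X_0,X_1\in\mathcal C$. A category is *quasi-Frobenius* if it is an abelian category with enough projectives in which all projective objects are injective. *)

(* Defs.v *)
From HB Require Import structures.
From mathcomp Require Import all_boot all_algebra.
From mathcomp Require Import boolp.

Set Implicit Arguments.
Unset Strict Implicit.
Unset Printing Implicit Defensive.

Import GRing.Theory.
Local Open Scope ring_scope.

Section Rings.
Variable R : comNzRingType.

Definition ideal (I : R -> Prop) : Prop :=
  [/\ I 0, forall x y, I x -> I y -> I (x + y) & forall a x, I x -> I (a * x)].

Definition ideal_fg (I : R -> Prop) : Prop :=
  exists (n : nat) (e : 'I_n -> R),
    forall x, I x <-> exists c : 'I_n -> R, x = \sum_i c i * e i.

Definition noetherian : Prop := forall I, ideal I -> ideal_fg I.

Definition maximal_ideal (m : R -> Prop) : Prop :=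
  [/\ ideal m, ~ m 1 &
      forall I, ideal I -> (forall x, m x -> I x) -> ~ I 1 ->
        forall x, I x -> m x].

Definition local_with (m : R -> Prop) : Prop :=
  maximal_ideal m /\
  forall m', maximal_ideal m' -> forall x, m' x <-> m x.

(* A simple root, in the residue field R/m, of the reduction of a monic
   polynomial over R lifts to a root in R. *)
Definition henselian_at (m : R -> Prop) : Prop :=
  forall (f : {poly R}) (a : R),
    f \is monic -> m f.[a] -> ~ m (f^`()).[a] ->
    exists b : R, f.[b] = 0 /\ m (b - a).

Definition henselian_local : Prop :=
  exists m, local_with m /\ henselian_at m.

End Rings.

Section Modules.
Variable R : comNzRingType.
Implicit Types X Y Z P N : lmodType R.

Definition fin_gen X : Prop :=
  exists (n : nat) (e : 'I_n -> X),
    forall x, exists c : 'I_n -> R, x = \sum_i c i *: e i.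

Definition surjective (A B : Type) (f : A -> B) : Prop :=
  forall b, exists a, f a = b.

Definition exact_at (A B : Type) (D : zmodType) (f : A -> B) (g : B -> D) :
  Prop := forall b, g b = 0 <-> exists a, f a = b.

Definition short_exact X Y Z (f : {linear X -> Y}) (g : {linear Y -> Z}) :
  Prop := [/\ injective f, exact_at f g & surjective g].

Definition projective P : Prop :=
  forall Y Z (g : {linear Y -> Z}) (f : {linear P -> Z}),
    surjective g -> exists h : {linear P -> Y}, forall x, g (h x) = f x.

Record subcategory (C : lmodType R -> Prop) : Prop := Subcategory {
  subcat_fin_gen : forall X, C X -> fin_gen X;
  subcat_iso : forall X Y (f : {linear X -> Y}), bijective f -> C X -> C Y;
  subcat_sum : forall X Y, fin_gen X -> fin_gen Y ->
    C (X * Y)%type <-> C X /\ C Y;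
  subcat_projective : forall P, fin_gen P -> projective P -> C P
}.

Record resolving (C : lmodType R -> Prop) : Prop := Resolving {
  resolving_subcategory : subcategory C;
  resolving_extension :
    forall X Y Z (f : {linear X -> Y}) (g : {linear Y -> Z}),
      fin_gen X -> fin_gen Y -> fin_gen Z -> short_exact f g ->
      C X -> C Z -> C Y;
  resolving_kernel :
    forall X Y Z (f : {linear X -> Y}) (g : {linear Y -> Z}),
      fin_gen X -> fin_gen Y -> fin_gen Z -> short_exact f g ->
      C Y -> C Z -> C X
}.

Record proj_resolution X := ProjResolution {
  res_obj : nat -> lmodType R;
  res_diff : forall i, {linear res_obj i.+1 -> res_obj i};
  res_aug : {linear res_obj 0 -> X};
  res_projective : forall i, projective (res_obj i);
  res_aug_surj : surjective res_aug;
  res_exact0 : exact_at (res_diff 0) res_aug;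
  res_exact : forall i, exact_at (res_diff i.+1) (res_diff i)
}.

Definition ext_cocycle X (Q : proj_resolution X) N i
    (f : {linear res_obj Q i -> N}) : Prop :=
  forall x, f (res_diff Q i x) = 0.

Definition ext_coboundary X (Q : proj_resolution X) N i :
    {linear res_obj Q i -> N} -> Prop :=
  match i with
  | 0 => fun f => forall x, f x = 0
  | j.+1 => fun f => exists g : {linear res_obj Q j -> N},
                       forall x, f x = g (res_diff Q j x)
  end.

(* Ext^i(X, N) is the i-th cohomology group of Hom(Q, N) for a projective
   resolution Q of X.  As it does not depend on Q up to isomorphism, its
   vanishing may be tested on any one resolution. *)
Definition Ext_vanishes i X N : Prop :=
  exists Q : proj_resolution X,
    forall f : {linear res_obj Q i -> N}, ext_cocycle f -> ext_coboundary f.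

Definition catH X : Prop :=
  fin_gen X /\ forall i, (0 < i)%N -> Ext_vanishes i X R^o.

(* An alias of {linear X -> Y}, to carry its abelian group structure. *)
Definition lhom X Y : Type := {linear X -> Y}.

Definition lcomp X Y Z (g : lhom Y Z) (f : lhom X Y) : lhom X Z :=
  (g : {linear Y -> Z}) \o (f : {linear X -> Y}).

Definition lid X : lhom X X := idfun.

Lemma lhomP X Y (f g : lhom X Y) :
  (forall x, (f : {linear X -> Y}) x = (g : {linear X -> Y}) x) -> f = g.
Proof.
move=> fg; rewrite -[f]/(f : {linear X -> Y}) -[g]/(g : {linear X -> Y}).
have {fg} : ((f : {linear X -> Y}) : X -> Y) = (g : {linear X -> Y}).
  by apply: funext.
case: f g => f [f1 f2] [g [g1 g2]] /= E; subst g.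
congr GRing.Linear.Pack; case: f1 f2 g1 g2 => f1 [f2] [g1] [g2].
by rewrite (Prop_irrelevance f1 g1) (Prop_irrelevance f2 g2).
Qed.

End Modules.

HB.instance Definition _ (R : comNzRingType) (X Y : lmodType R) :=
  gen_eqMixin (lhom X Y).
HB.instance Definition _ (R : comNzRingType) (X Y : lmodType R) :=
  gen_choiceMixin (lhom X Y).

Section LinearMaps.
Variables (R : comNzRingType) (X Y : lmodType R).
Implicit Types f g h : lhom X Y.

Definition lhom_zero : lhom X Y := \0.
Definition lhom_opp f : lhom X Y := \- (f : {linear X -> Y}).
Definition lhom_add f g : lhom X Y :=
  (f : {linear X -> Y}) \+ (g : {linear X -> Y}).

Lemma lhom_addA : associative lhom_add.
Proof. by move=> f g h; apply: lhomP => x /=; rewrite addrA. Qed.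
Lemma lhom_addC : commutative lhom_add.
Proof. by move=> f g; apply: lhomP => x /=; rewrite addrC. Qed.
Lemma lhom_add0 : left_id lhom_zero lhom_add.
Proof. by move=> f; apply: lhomP => x /=; rewrite add0r. Qed.
Lemma lhom_addN : left_inverse lhom_zero lhom_opp lhom_add.
Proof. by move=> f; apply: lhomP => x /=; rewrite addNr. Qed.

HB.instance Definition _ :=
  GRing.isZmodule.Build (lhom X Y) lhom_addA lhom_addC lhom_add0 lhom_addN.

Definition factors_through_projective (f : lhom X Y) : Prop :=
  exists (P : lmodType R) (a : lhom X P) (b : lhom P Y),
    projective P /\ f = lcomp b a.

Definition stable_ideal : {pred lhom X Y} :=
  fun f => `[< factors_through_projective f >].

End LinearMaps.
Arguments stable_ideal {R} X Y.

Section Stable.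
Variable R : comNzRingType.
Implicit Types X Y Z P Q : lmodType R.

Definition lhom_of X Y (f : X -> Y) (fl : linear f) : lhom X Y :=
  HB.pack_for {linear X -> Y} f (GRing.isLinear.Build R X Y _ f fl).

Lemma lcompA W X Y Z (h : lhom Y Z) (g : lhom X Y) (f : lhom W X) :
  lcomp h (lcomp g f) = lcomp (lcomp h g) f.
Proof. exact: lhomP. Qed.

Lemma lcompid X Y (f : lhom X Y) : lcomp f (lid X) = f.
Proof. exact: lhomP. Qed.

Lemma lidcomp X Y (f : lhom X Y) : lcomp (lid Y) f = f.
Proof. exact: lhomP. Qed.

Lemma lcompDl X Y Z (g g' : lhom Y Z) (f : lhom X Y) :
  lcomp (g + g') f = lcomp g f + lcomp g' f.
Proof. exact: lhomP. Qed.

Lemma lcompDr X Y Z (g : lhom Y Z) (f f' : lhom X Y) :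
  lcomp g (f + f') = lcomp g f + lcomp g f'.
Proof. by apply: lhomP => x; apply: (linearD (g : {linear Y -> Z})). Qed.

Lemma lcompBl X Y Z (g g' : lhom Y Z) (f : lhom X Y) :
  lcomp (g - g') f = lcomp g f - lcomp g' f.
Proof. exact: lhomP. Qed.

Lemma lcompBr X Y Z (g : lhom Y Z) (f f' : lhom X Y) :
  lcomp g (f - f') = lcomp g f - lcomp g f'.
Proof. by apply: lhomP => x; apply: (linearB (g : {linear Y -> Z})). Qed.

Lemma projective_prod P Q : projective P -> projective Q ->
  projective (P * Q)%type.
Proof.
move=> pP pQ Y Z g f gs.
have iPl : linear (fun x : P => (x, 0) : P * Q).
  by move=> a x y; congr pair; rewrite /= scaler0 addr0.
have iQl : linear (fun x : Q => (0, x) : P * Q).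
  by move=> a x y; congr pair; rewrite /= scaler0 addr0.
have [u Hu] := pP _ _ g (lcomp f (lhom_of iPl)) gs.
have [v Hv] := pQ _ _ g (lcomp f (lhom_of iQl)) gs.
have hl : linear (fun x : P * Q => u x.1 + v x.2).
  by move=> a x y /=; rewrite !linearP /= scalerDr addrACA.
exists (lhom_of hl).
case=> p q /=; rewrite linearD Hu Hv /= -linearD; congr (f _).
by congr pair; rewrite /= ?addr0 ?add0r.
Qed.

Lemma projective0 : projective 'rV[R]_0.
Proof.
move=> Y Z g f gs; exists \0 => x.
by rewrite (_ : x = 0) ?linear0 //; apply/rowP; case.
Qed.

Lemma stable_ideal_closed X Y : zmod_closed (stable_ideal X Y).
Proof.
split; first by apply/asboolP; exists 'rV[R]_0, \0, \0; split;
  [exact: projective0 | exact: lhomP].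
move=> f g /asboolP[P [a [b [pP ->]]]] /asboolP[Q [c [d [pQ ->]]]].
have ul : linear (fun x : X =>
    ((a : {linear X -> P}) x, (c : {linear X -> Q}) x) : P * Q).
  by move=> k x y /=; rewrite !linearP.
have vl : linear (fun x : P * Q =>
    (b : {linear P -> Y}) x.1 - (d : {linear Q -> Y}) x.2).
  by move=> k x y /=; rewrite !linearP /= scalerDr addrACA.
apply/asboolP; exists (P * Q)%type, (lhom_of ul), (lhom_of vl).
by split; [exact: projective_prod | exact: lhomP].
Qed.

HB.instance Definition _ X Y :=
  GRing.isZmodClosed.Build (lhom X Y) (stable_ideal X Y)
    (stable_ideal_closed X Y).

Lemma stable_ideal_compl X Y Z (g : lhom Y Z) (f : lhom X Y) :
  f \in stable_ideal X Y -> lcomp g f \in stable_ideal X Z.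
Proof.
move=> /asboolP[P [a [b [pP ->]]]]; apply/asboolP.
by exists P, a, (lcomp g b); rewrite lcompA.
Qed.

Lemma stable_ideal_compr X Y Z (g : lhom Y Z) (f : lhom X Y) :
  g \in stable_ideal Y Z -> lcomp g f \in stable_ideal X Z.
Proof.
move=> /asboolP[P [a [b [pP ->]]]]; apply/asboolP.
by exists P, (lcomp a f), b; rewrite lcompA.
Qed.

Definition stable_hom X Y : zmodType := {ideal_quot stable_ideal X Y}.

Definition stable_class X Y (f : lhom X Y) : stable_hom X Y :=
  \pi_({ideal_quot stable_ideal X Y})%qT f.

Definition stable_rep X Y (u : stable_hom X Y) : lhom X Y :=
  repr (u : {ideal_quot stable_ideal X Y}).

Definition stable_id X : stable_hom X X := stable_class (lid X).

Definition stable_comp X Y Z (v : stable_hom Y Z) (u : stable_hom X Y) :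
    stable_hom X Z :=
  stable_class (lcomp (stable_rep v) (stable_rep u)).

Lemma stable_repK X Y (u : stable_hom X Y) : stable_class (stable_rep u) = u.
Proof. exact: reprK. Qed.

Lemma stable_classP X Y (f g : lhom X Y) :
  stable_class f = stable_class g <-> factors_through_projective (f - g).
Proof.
split=> [/eqP|fg]; first by rewrite -Quotient.idealrBE => /asboolP.
by apply/eqP; rewrite -Quotient.idealrBE; apply/asboolP.
Qed.

Lemma stable_classD X Y (f g : lhom X Y) :
  stable_class (f + g) = stable_class f + stable_class g.
Proof. exact: (raddfD (\pi_({ideal_quot stable_ideal X Y})%qT)). Qed.

Lemma stable_compE X Y Z (g : lhom Y Z) (f : lhom X Y) :
  stable_comp (stable_class g) (stable_class f) = stable_class (lcomp g f).
Proof.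
have h A B (k : lhom A B) :
  stable_rep (stable_class k) - k \in stable_ideal A B.
  by apply/asboolP/stable_classP; rewrite stable_repK.
apply/stable_classP; set g' := stable_rep _; set f' := stable_rep _.
suff: lcomp g' f' - lcomp g f \in stable_ideal X Z by move/asboolP.
rewrite (_ : _ - _ = lcomp g' (f' - f) + lcomp (g' - g) f).
  apply: rpredD; first by apply: stable_ideal_compl; exact: h.
  by apply: stable_ideal_compr; exact: h.
by rewrite lcompBr lcompBl addrA subrK.
Qed.

Lemma stable_compA W X Y Z (w : stable_hom Y Z) (v : stable_hom X Y)
    (u : stable_hom W X) :
  stable_comp w (stable_comp v u) = stable_comp (stable_comp w v) u.
Proof.
by rewrite -[w]stable_repK -[v]stable_repK -[u]stable_repK !stable_compE lcompA.
Qed.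

Lemma stable_compid X Y (u : stable_hom X Y) : stable_comp u (stable_id X) = u.
Proof. by rewrite -[u]stable_repK stable_compE lcompid. Qed.

Lemma stable_idcomp X Y (u : stable_hom X Y) : stable_comp (stable_id Y) u = u.
Proof. by rewrite -[u]stable_repK stable_compE lidcomp. Qed.

Lemma stable_compDl X Y Z (v v' : stable_hom Y Z) (u : stable_hom X Y) :
  stable_comp (v + v') u = stable_comp v u + stable_comp v' u.
Proof.
rewrite -[v]stable_repK -[v']stable_repK -[u]stable_repK.
by rewrite -stable_classD !stable_compE -stable_classD lcompDl.
Qed.

Lemma stable_compDr X Y Z (v : stable_hom Y Z) (u u' : stable_hom X Y) :
  stable_comp v (u + u') = stable_comp v u + stable_comp v u'.
Proof.
rewrite -[v]stable_repK -[u]stable_repK -[u']stable_repK.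
by rewrite -stable_classD !stable_compE -stable_classD lcompDr.
Qed.

End Stable.

(* Hom sets carry a bare abelian group structure rather than a zmodType one:
   the natural transformations between functors on a large category live in a
   universe above that of the carriers of zmodType. *)
Record preadditive := Preadditive {
  ob :> Type;
  hom : ob -> ob -> Type;
  idm : forall A, hom A A;
  comp : forall A B D, hom B D -> hom A B -> hom A D;
  hzero : forall A B, hom A B;
  hopp : forall A B, hom A B -> hom A B;
  hadd : forall A B, hom A B -> hom A B -> hom A B;
  comp_assoc : forall A B D E (h : hom D E) (g : hom B D) (f : hom A B),
    comp h (comp g f) = comp (comp h g) f;
  comp_idl : forall A B (f : hom A B), comp (idm B) f = f;
  comp_idr : forall A B (f : hom A B), comp f (idm A) = f;
  hadd_assoc : forall A B, associative (@hadd A B);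
  hadd_comm : forall A B, commutative (@hadd A B);
  hadd_zero : forall A B, left_id (hzero A B) (@hadd A B);
  hadd_opp : forall A B, left_inverse (hzero A B) (@hopp A B) (@hadd A B);
  comp_addl : forall A B D (g g' : hom B D) (f : hom A B),
    comp (hadd g g') f = hadd (comp g f) (comp g' f);
  comp_addr : forall A B D (g : hom B D) (f f' : hom A B),
    comp g (hadd f f') = hadd (comp g f) (comp g f')
}.
Arguments hom {p} A B.
Arguments idm {p} A.
Arguments comp {p A B D} g f.
Arguments hzero {p A B}.
Arguments hopp {p A B} f.
Arguments hadd {p A B} f g.

Section Abelian.
Variable A : preadditive.
Implicit Types X Y Z K : A.

Definition mono X Y (f : hom X Y) : Prop :=
  forall Z (g h : hom Z X), comp f g = comp f h -> g = h.

Definition epi X Y (f : hom X Y) : Prop :=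
  forall Z (g h : hom Y Z), comp g f = comp h f -> g = h.

Definition zero_object X : Prop :=
  forall Y, (forall f g : hom X Y, f = g) /\ (forall f g : hom Y X, f = g).

Definition biproduct X Y Z : Prop :=
  exists (i1 : hom X Z) (i2 : hom Y Z) (p1 : hom Z X) (p2 : hom Z Y),
    [/\ comp p1 i1 = idm X, comp p2 i2 = idm Y,
        comp p1 i2 = hzero, comp p2 i1 = hzero &
        hadd (comp i1 p1) (comp i2 p2) = idm Z].

Definition is_kernel X Y K (f : hom X Y) (k : hom K X) : Prop :=
  comp f k = hzero /\
  forall Z (g : hom Z X), comp f g = hzero ->
    exists! h : hom Z K, comp k h = g.

Definition is_cokernel X Y K (f : hom X Y) (c : hom Y K) : Prop :=
  comp c f = hzero /\
  forall Z (g : hom Y Z), comp g f = hzero ->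
    exists! h : hom K Z, comp h c = g.

Record abelian : Prop := Abelian {
  ab_zero : exists X, zero_object X;
  ab_biproduct : forall X Y, exists Z, biproduct X Y Z;
  ab_kernel : forall X Y (f : hom X Y),
    exists K (k : hom K X), is_kernel f k;
  ab_cokernel : forall X Y (f : hom X Y),
    exists K (c : hom Y K), is_cokernel f c;
  ab_mono : forall X Y (f : hom X Y), mono f ->
    exists Z (g : hom Y Z), is_kernel g f;
  ab_epi : forall X Y (f : hom X Y), epi f ->
    exists Z (g : hom Z X), is_cokernel g f
}.

Definition projective_object X : Prop :=
  forall Y Z (e : hom Y Z) (f : hom X Z), epi e ->
    exists g : hom X Y, comp e g = f.

Definition injective_object X : Prop :=
  forall Y Z (m : hom Y Z) (f : hom Y X), mono m ->
    exists g : hom Z X, comp g m = f.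

Definition enough_projectives : Prop :=
  forall X, exists Q (e : hom Q X), projective_object Q /\ epi e.

Definition quasi_frobenius : Prop :=
  [/\ abelian, enough_projectives &
      forall X, projective_object X -> injective_object X].

End Abelian.

Section StableFunctors.
Variables (R : comNzRingType) (C : lmodType R -> Prop).

Record stable_ob := StableOb { ob_mod :> lmodType R; ob_in : C ob_mod }.

Record stable_functor := StableFunctor {
  fun_ob :> stable_ob -> zmodType;
  fun_map : forall X Y : stable_ob,
    stable_hom X Y -> {additive fun_ob Y -> fun_ob X};
  fun_map_id : forall (X : stable_ob) x, fun_map (stable_id X) x = x;
  fun_map_comp : forall (X Y Z : stable_ob)
    (v : stable_hom Y Z) (u : stable_hom X Y) z,
    fun_map (stable_comp v u) z = fun_map u (fun_map v z);
  fun_map_add : forall (X Y : stable_ob) (u v : stable_hom X Y) y,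
    fun_map (u + v) y = fun_map u y + fun_map v y
}.

Record nat_trans (F G : stable_functor) := NatTrans {
  nt_app :> forall X, {additive F X -> G X};
  nt_natural : forall (X Y : stable_ob) (u : stable_hom X Y) y,
    nt_app X (fun_map F u y) = fun_map G u (nt_app Y y)
}.

Lemma additiveP (U V : zmodType) (f g : {additive U -> V}) : f =1 g -> f = g.
Proof.
move=> /funext; case: f g => f [f1] [g [g1]] /= E; subst g.
congr Algebra.Additive.Pack; by case: f1 g1 => [f1] [g1]; rewrite (Prop_irrelevance f1 g1).
Qed.

Lemma nat_transP F G (a b : nat_trans F G) :
  (forall X x, a X x = b X x) -> a = b.
Proof.
case: a b => [a na] [b nb] /= ab.
have E : a = b.
  by apply: functional_extensionality_dep => X; apply: additiveP => x; apply: ab.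
by subst b; congr NatTrans; apply: Prop_irrelevance.
Qed.

Section Representable.
Variable X : stable_ob.

Section Map.
Variables (Y Z : stable_ob) (u : stable_hom Y Z).
Definition precomp (v : stable_hom Z X) : stable_hom Y X := stable_comp v u.
Lemma precomp_additive : zmod_morphism precomp.
Proof.
have D v w : precomp (v + w) = precomp v + precomp w.
  by rewrite /precomp stable_compDl.
by move=> v w; apply: (addIr (precomp w)); rewrite -D !subrK.
Qed.
HB.instance Definition _ := GRing.isZmodMorphism.Build _ _ precomp
  precomp_additive.
End Map.

Definition representable : stable_functor.
Proof.
refine (@StableFunctor (fun Y => stable_hom Y X) (fun Y Z u => precomp u)
  _ _ _).
- by move=> Y x; apply: stable_compid.
- by move=> Y Z W v u z; rewrite /= /precomp stable_compA.
- by move=> Y Z u v y; apply: stable_compDr.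
Defined.

End Representable.

Definition finitely_presented (F : stable_functor) : Prop :=
  exists (X1 X0 : stable_ob)
         (a : nat_trans (representable X1) (representable X0))
         (b : nat_trans (representable X0) F),
    forall Y, exact_at (a Y) (b Y) /\ surjective (b Y).

Record fp_functor := FPFunctor {
  fp_fun :> stable_functor;
  fp_presented : finitely_presented fp_fun
}.

Definition nt_id F : nat_trans F F.
Proof. by exists (fun X => idfun). Defined.

Definition nt_comp F G H (b : nat_trans G H) (a : nat_trans F G) :
  nat_trans F H.
Proof.
exists (fun X => b X \o a X).
by move=> X Y u y /=; rewrite !nt_natural.
Defined.

Definition nt_zero F G : nat_trans F G.
Proof. by exists (fun X => \0) => X Y u y; rewrite raddf0. Defined.

Definition nt_opp F G (a : nat_trans F G) : nat_trans F G.
Proof.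
by exists (fun X => \- a X) => X Y u y /=; rewrite nt_natural raddfN.
Defined.

Definition nt_add F G (a b : nat_trans F G) : nat_trans F G.
Proof.
by exists (fun X => a X \+ b X) => X Y u y /=; rewrite !nt_natural raddfD.
Defined.

Definition mod_stable : preadditive.
Proof.
refine (@Preadditive fp_functor (fun F G => nat_trans F G) (fun F => nt_id F)
  (fun F G H b a => nt_comp b a) (fun F G => nt_zero F G)
  (fun F G a => nt_opp a) (fun F G a b => nt_add a b) _ _ _ _ _ _ _ _ _).
- by move=> *; apply: nat_transP.
- by move=> *; apply: nat_transP.
- by move=> *; apply: nat_transP.
- by move=> F G a b d; apply: nat_transP => X x /=; rewrite addrA.
- by move=> F G a b; apply: nat_transP => X x /=; rewrite addrC.
- by move=> F G a; apply: nat_transP => X x /=; rewrite add0r.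
- by move=> F G a; apply: nat_transP => X x /=; rewrite addNr.
- by move=> *; apply: nat_transP.
- by move=> F G H b a a'; apply: nat_transP => X x /=; rewrite raddfD.
Defined.

End StableFunctors.

(* Main.v *)
(* Let 0 -> R -> Y -> X -> 0 be exact with X in C.  The stable functor Hom(-, R)
   vanishes, so Hom(-, Y) -> Hom(-, X) is a monomorphism in mod C; its source is
   projective, hence injective, so it splits: 1_Y = r g + b a with b a through a
   free module.  It follows that every cyclic submodule of Ext^1(X, R) is a direct
   summand, so the maximal ideal m kills Ext^1(X, R), for every X in C.

   The same equation yields y in Y and f : Y -> R with f y = 1 such that every
   linear form on X maps g y into m; otherwise a could be chosen with values in
   m R^n, and then 1 - b a would be injective and kill the image of R.  Let x be
   the value of f at the image of 1; if x is a unit the sequence splits.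
   Otherwise push it out along y : R -> Y and along g y : R -> X.  This gives an
   extension W of X by X, which lies in C, and a class in Ext^1(W, R)
   restricting to the class of Y on the submodule X.  As x kills it, there is a
   form on Y that sends the image of 1 to a unit.  Hence Ext^1(X, R) = 0 for all
   X in C, and the higher Ext follow by passing to syzygies. *)
Require Import Defs.
From HB Require Import structures.
From mathcomp Require Import all_boot all_algebra.
From mathcomp Require Import perm boolp classical_sets.

Set Implicit Arguments.
Unset Strict Implicit.
Unset Printing Implicit Defensive.

Import GRing.Theory.
Local Open Scope ring_scope.

(** * Modules and pushouts *)

(** Membership is a proposition, so that kernels, preimages and images given by existential
    conditions qualify; [asbool] turns it into the boolean predicate on which the subtype and
    quotient structures rest. *)
Record submodule (R : comNzRingType) (V : lmodType R) := Submodule {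
  sub_carrier :> V -> Prop;
  submodule0 : sub_carrier 0;
  submoduleP : forall (a : R) x y,
    sub_carrier x -> sub_carrier y -> sub_carrier (a *: x + y)
}.

Section Submodules.
Variables (R : comNzRingType) (V : lmodType R) (S : submodule V).

Definition sub_pred : {pred V} := fun x => `[< S x >].

Lemma sub_pred_closed : submod_closed sub_pred.
Proof.
split; first by apply/asboolP; apply: submodule0.
by move=> a x y /asboolP Sx /asboolP Sy; apply/asboolP; apply: submoduleP.
Qed.

HB.instance Definition _ :=
  GRing.isSubmodClosed.Build R V sub_pred sub_pred_closed.

Record sub_type := SubElt { sub_val : V; _ : sub_val \in sub_pred }.
HB.instance Definition _ := [isSub for sub_val].
HB.instance Definition _ := [Choice of sub_type by <:].
HB.instance Definition _ := [SubChoice_isSubLmodule of sub_type by <:].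

Lemma submodule_exists : exists (K : lmodType R) (k : {linear K -> V}),
  injective k /\ forall x, S x <-> exists u, k u = x.
Proof.
exists sub_type, (val : {linear sub_type -> V}); split; first exact: val_inj.
move=> x; split=> [/asboolP Sx|[u <-]]; first by exists (SubElt Sx).
by apply/asboolP; apply: (valP u).
Qed.

(** The quotient by an additive predicate is only an abelian group; scaling is transported to it
    below through representatives. *)
Definition quot_type := {ideal_quot sub_pred}.
HB.instance Definition _ := GRing.Zmodule.on quot_type.

Definition quot_pi (x : V) : quot_type := \pi_({ideal_quot sub_pred})%qT x.

Lemma quot_piP x y : quot_pi x = quot_pi y <-> S (x - y).
Proof.
split=> [/eqP|Sxy]; first by rewrite -Quotient.idealrBE => /asboolP.
by apply/eqP; rewrite -Quotient.idealrBE; apply/asboolP.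
Qed.

Lemma quot_piD : {morph quot_pi : x y / x + y}.
Proof. exact: (raddfD (\pi_({ideal_quot sub_pred})%qT)). Qed.

Lemma quot_piK x : quot_pi (repr (x : {ideal_quot sub_pred})) = x.
Proof. exact: reprK. Qed.

Definition quot_scale (a : R) (x : quot_type) : quot_type :=
  quot_pi (a *: repr (x : {ideal_quot sub_pred})).

Lemma quot_scaleE a x : quot_scale a (quot_pi x) = quot_pi (a *: x).
Proof.
apply/quot_piP; rewrite -scalerBr -[_ *: _]addr0.
by apply: submoduleP (submodule0 S); apply/quot_piP; rewrite quot_piK.
Qed.

Lemma quot_scaleA a b x : quot_scale a (quot_scale b x) = quot_scale (a * b) x.
Proof. by rewrite -[x]quot_piK !quot_scaleE scalerA. Qed.
Lemma quot_scale1 : left_id 1 quot_scale.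
Proof. by move=> x; rewrite -[x]quot_piK !quot_scaleE scale1r. Qed.
Lemma quot_scaleDr : right_distributive quot_scale +%R.
Proof.
move=> a x y; rewrite -[x]quot_piK -[y]quot_piK -quot_piD !quot_scaleE.
by rewrite -quot_piD scalerDr.
Qed.
Lemma quot_scaleDl x : {morph quot_scale^~ x : a b / a + b}.
Proof. by move=> a b; rewrite -[x]quot_piK !quot_scaleE -quot_piD scalerDl. Qed.

HB.instance Definition _ := GRing.Zmodule_isLmodule.Build R quot_type
  quot_scaleA quot_scale1 quot_scaleDr quot_scaleDl.

Lemma quotient_exists : exists (Q : lmodType R) (p : {linear V -> Q}),
  surjective p /\ forall x, p x = 0 <-> S x.
Proof.
have pl : linear quot_pi.
  by move=> a x y; rewrite quot_piD -quot_scaleE.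
exists quot_type, (lhom_of pl : {linear V -> quot_type}); split=> [x|x] /=.
  by exists (repr (x : {ideal_quot sub_pred})); apply: quot_piK.
have -> : (0 : quot_type) = quot_pi 0.
  by apply: (addIr (quot_pi 0)); rewrite -quot_piD !add0r.
by rewrite -[X in S X]subr0; apply: quot_piP.
Qed.

End Submodules.

Lemma linear_fun (R : comNzRingType) (X Y : lmodType R) (f : X -> Y) :
  linear f -> exists h : {linear X -> Y}, h =1 f.
Proof. by move=> fl; exists (lhom_of fl : {linear X -> Y}). Qed.

(** * Linear maps, finite generation and pushouts *)

Section Modules.
Variable R : comNzRingType.
Implicit Types A D K T X Y Z : lmodType R.

Lemma factor_surjective Y X Z (g : {linear Y -> X}) (f : {linear Y -> Z}) :
  surjective g -> (forall y, g y = 0 -> f y = 0) ->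
  exists h : {linear X -> Z}, forall y, h (g y) = f y.
Proof.
move=> /choice[s sK] gf.
have fE y y' : g y = g y' -> f y = f y'.
  by move=> E; apply/eqP; rewrite -subr_eq0 -linearB gf // linearB E subrr.
have hl : linear (fun x => f (s x)).
  by move=> a x y; rewrite -linearP; apply: fE; rewrite linearP !sK.
have [h hE] := linear_fun hl.
by exists h => y; rewrite hE; apply: fE; rewrite sK.
Qed.

Lemma factor_injective A Y X (i : {linear A -> Y}) (f : {linear X -> Y}) :
  injective i -> (forall x, exists a, i a = f x) ->
  exists h : {linear X -> A}, forall x, i (h x) = f x.
Proof.
move=> i_inj /choice[h hE].
have hl : linear h by move=> a x y; apply: i_inj; rewrite linearP !hE linearP.
by have [k kE] := linear_fun hl; exists k => x; rewrite kE.
Qed.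

Lemma regular_linear X (x : X) :
  exists f : {linear R^o -> X}, forall c : R, f c = c *: x.
Proof.
have fl : linear (fun c : R^o => (c : R) *: x).
  by move=> a b c; rewrite scalerDl scalerA.
by have [f fE] := linear_fun fl; exists f => c; rewrite fE.
Qed.

Lemma regularE X (f : {linear R^o -> X}) (c : R) : f c = c *: f 1.
Proof. by rewrite -linearZ /= -[c in LHS]mulr1. Qed.

Lemma row_linear X n (e : 'I_n -> X) :
  exists f : {linear 'rV[R]_n -> X}, forall v, f v = \sum_i v 0 i *: e i.
Proof.
have fl : linear (fun v : 'rV[R]_n => \sum_i v 0 i *: e i).
  move=> a v w; rewrite scaler_sumr -big_split; apply: eq_bigr => i _.
  by rewrite !mxE scalerDl scalerA.
by have [f fE] := linear_fun fl; exists f => v; rewrite fE.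
Qed.

Lemma projective_row n : projective 'rV[R]_n.
Proof.
move=> Y Z g f /choice[s sK].
have [h hE] := row_linear (fun i => s (f (delta_mx 0 i))).
exists h => v; rewrite hE linear_sum [v in RHS]row_sum_delta linear_sum.
by apply: eq_bigr => i _; rewrite !linearZ /= sK.
Qed.

Lemma projective_regular : projective R^o.
Proof.
move=> Y Z g f /(_ (f 1))[y yE]; have [h hE] := regular_linear y.
by exists h => c; rewrite hE linearZ /= yE -regularE.
Qed.

Lemma fin_gen_row n : fin_gen 'rV[R]_n.
Proof.
by exists n, (delta_mx 0) => v; exists (v 0); apply: row_sum_delta.
Qed.

Lemma fin_gen_regular : fin_gen R^o.
Proof.
by exists 1%N, (fun=> 1) => x; exists (fun=> x); rewrite big_ord1 [RHS]mulr1.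
Qed.

Lemma fin_gen_cover X : fin_gen X ->
  exists n (p : {linear 'rV[R]_n -> X}), surjective p.
Proof.
move=> [n [e eP]]; have [p pE] := row_linear e; exists n, p => x.
have [c ->] := eP x; exists (\row_i c i); rewrite pE.
by apply: eq_bigr => i _; rewrite mxE.
Qed.

Lemma fin_gen_image X Y (p : {linear X -> Y}) :
  surjective p -> fin_gen X -> fin_gen Y.
Proof.
move=> ps [n [e eP]]; exists n, (p \o e) => y; have [x <-] := ps y.
have [c ->] := eP x; exists c.
by rewrite linear_sum; apply: eq_bigr => i _; rewrite linearZ.
Qed.

(** Neither exactness on the left nor surjectivity of [g] is assumed: it is enough that the
    [g (u i)] generate the image of [g]. The induction in [noetherian_row] relies on this form. *)
Lemma fin_gen_extension A Y X (f : {linear A -> Y}) (g : {linear Y -> X})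
    n (u : 'I_n -> Y) :
  fin_gen A -> (forall y, g y = 0 -> exists a, f a = y) ->
  (forall y, exists c : 'I_n -> R, g y = \sum_i c i *: g (u i)) -> fin_gen Y.
Proof.
move=> [p [e eP]] fg gu.
exists (p + n)%N,
  (fun i => match split i with inl j => f (e j) | inr j => u j end).
move=> y; have [c cE] := gu y.
have /fg[a aE] : g (y - \sum_i c i *: u i) = 0.
  rewrite linearB linear_sum cE; apply/eqP; rewrite subr_eq0; apply/eqP.
  by apply: eq_bigr => i _; rewrite linearZ.
have [b bE] := eP a.
exists (fun i => match split i with inl j => b j | inr j => c j end).
rewrite big_split_ord -[LHS](subrK (\sum_i c i *: u i)) -aE bE linear_sum /=.
congr (_ + _); apply: eq_bigr => i _; last by rewrite (unsplitK (inr i)).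
by rewrite (unsplitK (inl i)) linearZ.
Qed.

Lemma fin_gen_short_exact A Y X (f : {linear A -> Y}) (g : {linear Y -> X}) :
  short_exact f g -> fin_gen A -> fin_gen X -> fin_gen Y.
Proof.
move=> [_ fg /choice[s sK]] Afg [n [e eP]].
apply: (@fin_gen_extension _ _ _ f g n (s \o e) Afg) => [y /fg //|y].
have [c ->] := eP (g y).
by exists c; apply: eq_bigr => i _; rewrite /= sK.
Qed.

Lemma kernel_exists X Y (f : {linear X -> Y}) :
  exists (K : lmodType R) (k : {linear K -> X}), injective k /\ exact_at k f.
Proof.
have Sl a x y : f x = 0 -> f y = 0 -> f (a *: x + y) = 0.
  by move=> x0 y0; rewrite linearP x0 y0 scaler0 addr0.
exact: (submodule_exists (Submodule (linear0 f) Sl)).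
Qed.

(** Induction on [n]: the first coordinates of the elements of [K] form an ideal, which is finitely
    generated, and the elements whose first coordinate is zero embed into a free module of smaller
    rank. *)
Lemma noetherian_row n K (k : {linear K -> 'rV[R]_n}) :
  noetherian R -> injective k -> fin_gen K.
Proof.
move=> noethR; elim: n K k => [|n IH] K k k_inj.
  exists 0%N, (fun=> 0) => x; exists (fun=> 0); rewrite big_ord0.
  by apply: k_inj; rewrite linear0; apply/rowP; case.
have [|m [e eP]] := noethR (fun c => exists u, k u 0 0 = c).
  split; first by exists 0; rewrite linear0 mxE.
    by move=> _ _ [u <-] [v <-]; exists (u + v); rewrite linearD mxE.
  by move=> a _ [u <-]; exists (a *: u); rewrite linearZ mxE.
have /choice[u uE] : forall i, exists x, k x 0 0 = e i.
  move=> i; apply/eP; exists (fun j => (j == i)%:R).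
  rewrite (bigD1 i) //= eqxx mul1r big1 ?addr0 // => j /negPf ->.
  by rewrite mul0r.
have hl : linear (fun x => k x 0 0 : R^o).
  by move=> a x y; rewrite linearP !mxE.
have [h hE] := linear_fun hl.
have [L [l [l_inj lh]]] := kernel_exists h.
have tl : linear (fun x => \row_(i < n) k (l x) 0 (lift 0 i)).
  by move=> a x y; apply/rowP => i; rewrite !linearP !mxE.
have [t tE] := linear_fun tl.
have /IH Lfg : injective t.
  move=> x y; rewrite !tE => E; apply/l_inj/k_inj/rowP => i.
  case: (unliftP 0 i) => [j ->|->].
    by move/rowP/(_ j): E; rewrite !mxE.
  by rewrite -!hE !(lh _).2 => *; [| exists y | exists x].
apply: (@fin_gen_extension _ _ _ l h m u Lfg) => [x /lh //|x].
have [c cE] := (eP (h x)).1 (ex_intro _ x (esym (hE x))).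
exists c; rewrite cE; apply: eq_bigr => i _.
by rewrite hE uE.
Qed.

(** The preimage of [K] in a free cover of [X] is finitely generated by [noetherian_row], and it
    maps onto [K]. *)
Lemma fin_gen_submodule X K (k : {linear K -> X}) :
  noetherian R -> fin_gen X -> injective k -> fin_gen K.
Proof.
move=> noethR /fin_gen_cover[n [p ps]] k_inj.
have S0 : exists u, k u = p 0 by exists 0; rewrite !linear0.
have Sl a x y : (exists u, k u = p x) -> (exists u, k u = p y) ->
    exists u, k u = p (a *: x + y).
  by move=> [u uE] [v vE]; exists (a *: u + v); rewrite !linearP uE vE.
have [L [l [l_inj lE]]] := submodule_exists (Submodule S0 Sl).
have [t tE] : exists t : {linear L -> K}, forall x, k (t x) = p (l x).
  by apply: (factor_injective (f := p \o l) k_inj) => x; apply/lE; exists x.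
apply: (fin_gen_image (p := t)) (noetherian_row noethR l_inj) => u.
have [v vE] := ps (k u).
have [x xE] : exists x, l x = v by apply/lE; exists u.
by exists x; apply: k_inj; rewrite tE xE.
Qed.

(** [E] is the quotient of [Y * D] by the pairs [(f a, - h a)]. The cokernel of [f] is unchanged,
    and [i] is injective because [f] is. *)
Lemma pushout_exists A Y X D (f : {linear A -> Y}) (g : {linear Y -> X})
    (h : {linear A -> D}) : short_exact f g ->
  exists (E : lmodType R) (i : {linear D -> E}) (u : {linear Y -> E})
      (q : {linear E -> X}),
    [/\ short_exact i q, forall a, u (f a) = i (h a),
        forall y, q (u y) = g y &
        forall (T : lmodType R) (s : {linear Y -> T}) (t : {linear D -> T}),
          (forall a, s (f a) = t (h a)) ->
          exists w : {linear E -> T},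
            (forall y, w (u y) = s y) /\ (forall d, w (i d) = t d)].
Proof.
move=> [f_inj fg gs].
pose S (z : Y * D) := exists a, f a = z.1 /\ h a = - z.2.
have S0 : S 0 by exists 0; split; rewrite linear0 ?[RHS]oppr0.
have Sl a z z' : S z -> S z' -> S (a *: z + z').
  move=> [b [b1 b2]] [c [c1 c2]]; exists (a *: b + c).
  by split; rewrite linearP ?b1 ?c1 // b2 c2 scalerN -opprD.
have [E [p [ps pS]]] := quotient_exists (Submodule S0 Sl).
have ul : linear (fun y => p (y, 0 : D)).
  move=> a x y; rewrite -linearP; congr (p _).
  by congr pair; rewrite /= scaler0 addr0.
have il : linear (fun d => p (0 : Y, d)).
  move=> a x y; rewrite -linearP; congr (p _).
  by congr pair; rewrite /= scaler0 addr0.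
have pE y d : p (y, d) = p (y, 0) + p (0, d).
  by rewrite -linearD; congr (p _); congr pair; rewrite /= ?addr0 ?add0r.
have [u uE] := linear_fun ul; have [i iE] := linear_fun il.
have compat (T : lmodType R) (s : {linear Y -> T}) (t : {linear D -> T}) :
    (forall a, s (f a) = t (h a)) -> exists w : {linear E -> T},
      (forall y, w (u y) = s y) /\ (forall d, w (i d) = t d).
  move=> st; have wl : linear (fun z : Y * D => s z.1 + t z.2).
    by move=> a x y /=; rewrite !linearP /= scalerDr addrACA.
  have [v vE] := linear_fun wl.
  have [z /pS[a [a1 a2]]|w wE] := factor_surjective (f := v) ps.
    by rewrite vE -a1 st a2 linearN addNr.
  exists w; split=> z; rewrite ?uE ?iE wE vE /= linear0 ?addr0 ?add0r //.
have uf a : u (f a) = i (h a).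
  apply/eqP; rewrite -subr_eq0 uE iE -linearB; apply/eqP/pS.
  by exists a; rewrite /= subr0 sub0r opprK.
have [|q [qu qi]] := compat _ g \0.
  by move=> a; apply/fg; exists a.
exists E, i, u, q; split=> //; split.
- move=> d d' dd'; apply/eqP; rewrite -subr_eq0.
  have /pS[a []] : p (0, d - d') = 0 by rewrite -iE linearB dd' subrr.
  move=> /= a1 a2; rewrite -oppr_eq0 -a2 (_ : a = 0) ?linear0 //.
  by apply: f_inj; rewrite a1 linear0.
- move=> e; split=> [|[d <-]]; last by rewrite qi.
  have [[y d] <-] := ps e; rewrite pE -uE -iE linearD qu qi addr0.
  by move=> /fg[a <-]; exists (h a + d); rewrite linearD uf.
- by move=> x; have [y <-] := gs x; exists (u y).
Qed.

End Modules.

(** * Local rings *)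

Section LocalRings.
Variables (R : comNzRingType) (m : R -> Prop).

Lemma idealN : ideal m -> forall x, m x -> m (- x).
Proof. by move=> [_ _ mM] x mx; rewrite -mulN1r; apply: mM. Qed.

Lemma idealB : ideal m -> forall x y, m x -> m y -> m (x - y).
Proof. by move=> mI x y mx /(idealN mI); case: mI => _ mD _; apply: mD. Qed.

Lemma ideal_sub_maximal (I : R -> Prop) : ideal I -> ~ I 1 ->
  exists n, maximal_ideal n /\ forall x, I x -> n x.
Proof.
move=> II I1.
pose P (A : set R) := [/\ ideal A, ~ A 1 & (I `<=` A)%classic] \/ A = set0.
have [F FP Ftot|A [PA Amax]] := @Zorn_bigcup R P.
  have [[A0 [FA0 A0n0]]|noA] :=
    pselect (exists A, F A /\ (A !=set0)%classic); last first.
    right; apply/seteqP; split=> // x [A FA Ax].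
    by case: noA; exists A; split=> //; exists x.
  have A0P A : F A -> (A !=set0)%classic ->
      [/\ ideal A, ~ A 1 & (I `<=` A)%classic].
    by move=> FA [x Ax]; case: (FP A FA) => // E; rewrite E in Ax.
  have [[A00 _ _] _ IA0] := A0P _ FA0 A0n0.
  left; split=> [|[A FA A1]|x Ix]; last by exists A0 => //; apply: IA0.
    split; first by exists A0.
      move=> x y [A FA Ax] [B FB By].
      have [[_ AD _] _ _] := A0P A FA (ex_intro _ x Ax).
      have [[_ BD _] _ _] := A0P B FB (ex_intro _ y By).
      case: (Ftot A B FA FB) => AB.
        by exists B => //; apply: BD => //; apply: AB.
      by exists A => //; apply: AD => //; apply: AB.
    move=> a x [A FA Ax]; have [[_ _ AM] _ _] := A0P A FA (ex_intro _ x Ax).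
    by exists A => //; apply: AM.
  by have [_ []] := A0P A FA (ex_intro _ 1 A1).
case: PA => [[AI A1 IA]|A0]; last first.
  exfalso; apply: (Amax I); last by left; split.
  by rewrite A0; split=> // /(_ 0); apply; case: II.
exists A; split=> //; split=> // B BI AB B1 x Bx; apply: contrapT => nAx.
apply: (Amax B); last by left; split=> // y /IA /AB.
by split=> // /(_ x Bx).
Qed.

(** Unless [x] is a unit, its multiples form a proper ideal, which lies in a maximal ideal, hence in
    [m]. *)
Lemma local_unit : local_with m -> forall x, ~ m x -> exists y, y * x = 1.
Proof.
move=> [_ m_uniq] x nmx; apply: contrapT => nx.
have [||n [n_max n_sub]] := @ideal_sub_maximal (fun z => exists y, z = y * x).
- split; first by exists 0; rewrite mul0r.
    by move=> _ _ [a ->] [b ->]; exists (a + b); rewrite mulrDl.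
  by move=> a _ [b ->]; exists (a * b); rewrite mulrA.
- by move=> [y yE]; apply: nx; exists y.
by apply/nmx/(m_uniq n n_max)/n_sub; exists 1; rewrite mul1r.
Qed.

Lemma local_unit_1B : local_with m ->
  forall x, m x -> exists y, y * (1 - x) = 1.
Proof.
move=> mL x mx; apply: (local_unit mL) => m1x; case: mL => [[[_ mD _] m1 _] _].
by apply: m1; rewrite -(subrK x 1); apply: mD.
Qed.

(** In the Leibniz expansion every permutation other than the identity contributes an off-diagonal
    factor, which lies in [m]; the diagonal product is 1 modulo [m]. *)
Lemma det_1B_ideal n (N : 'M[R]_n) : ideal m -> (forall i j, m (N i j)) ->
  m (\det (1%:M - N) - 1).
Proof.
move=> mI mN; have [m0 mD mM] := mI.
have mS (T : finType) (P : pred T) (F : T -> R) :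
    (forall t, P t -> m (F t)) -> m (\sum_(t | P t) F t) by exact: big_ind.
rewrite /determinant (bigD1 (1%g : 'S_n)) //= addrAC; apply: mD; last first.
  apply: mS => s s1; apply: (mM _ _).
  have [i si] : exists i, s i != i.
    apply/existsP; apply: contraR s1 => /existsPn s_id.
    apply/eqP/permP => i; rewrite perm1; apply/eqP.
    by move: (s_id i); rewrite negbK.
  rewrite (bigD1 i) //= mulrC; apply: mM.
  by rewrite !mxE eq_sym (negPf si) sub0r; apply: idealN.
rewrite odd_perm1 expr0 mul1r.
elim/big_rec: _ => [|i p _ mp]; first by rewrite subrr.
rewrite !mxE perm1 eqxx mulr1n mulrBl mul1r addrAC; apply: idealB => //.
by rewrite mulrC; apply: mM.
Qed.

(** Nakayama's lemma by the determinant trick: the adjugate of [1 - N] shows that its determinant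
    kills [v], and this determinant is a unit, being 1 modulo [m]. *)
Lemma fixed_row_eq0 n (N : 'M[R]_n) (v : 'rV[R]_n) :
  local_with m -> (forall i j, m (N i j)) -> v *m N = v -> v = 0.
Proof.
move=> mL mN vN; have mI : ideal m by case: mL => [[]].
have [y yE] := local_unit_1B mL (idealN mI (det_1B_ideal mI mN)).
rewrite opprK addrC subrK in yE.
rewrite -[v]scale1r -yE -scalerA -[\det _ *: v]mul_mx_scalar -mul_mx_adj.
by rewrite mulmxA mulmxBr mulmx1 vN subrr mul0mx scaler0.
Qed.

End LocalRings.

(** * Free direct summands of maximal rank *)

Section FreeRank.
Variables (R : comNzRingType) (m : R -> Prop) (mL : local_with m).
Variable X : lmodType R.

Definition free_summand d : Prop :=
  exists (t : {linear X -> 'rV[R]_d}) (z : {linear 'rV[R]_d -> X}),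
    cancel z t.

(** With a cover of [X] by a free module of rank [n], the section [z] lifts to the cover, so the
    identity matrix of size [d] factors through size [n]. *)
Lemma free_summand_bounded : fin_gen X ->
  exists n, forall d, free_summand d -> (d <= n)%N.
Proof.
move=> /fin_gen_cover[n [p ps]]; exists n => d [t [z tz]].
have [h hE] := @projective_row _ d _ _ p z ps.
apply: (@mulmx1_min R _ _ (lin1_mx h) (lin1_mx (t \o p))).
apply/row_matrixP => i; rewrite row1 rowE.
by rewrite mulmxA !mul_rV_lin1 /= hE tz.
Qed.

Lemma free_summandS d (t : {linear X -> 'rV[R]_d}) (z : {linear 'rV[R]_d -> X})
    (f : {linear X -> R^o}) x :
  cancel z t -> t x = 0 -> ~ m (f x) -> free_summand d.+1.
Proof.
move=> tz tx /(local_unit mL)[a afx].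
(* The new section sends the extra basis vector to [x]. Subtracting [a * f (z (t y))] makes the new
   coordinate vanish on the old summand, and the factor [a] gives it the value 1 at [x]. *)
have sl : linear (fun y =>
    row_mx ((a * f y - a * f (z (t y)))%:M : 'M_1) (t y) : 'rV_(1 + d)).
  move=> c y y'; rewrite scale_row_mx add_row_mx !linearP /=; congr row_mx.
  rewrite scale_scalar_mx -raddfD; congr (_%:M).
  by rewrite mulrBr !mulrDr !(mulrCA a) opprD addrACA.
have [s sE] := linear_fun sl.
have wl : linear (fun v : 'rV[R]_(1 + d) => lsubmx v 0 0 *: x + z (rsubmx v)).
  move=> c v v'; rewrite ![in LHS]linearP !mxE scalerDr scalerDl -scalerA.
  by rewrite addrACA.
have [w wE] := linear_fun wl.
have tw v : t (w v) = rsubmx v.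
  by rewrite wE linearD linearZ /= tx scaler0 add0r tz.
have sw (v : 'rV_(1 + d)) : s (w v) = v.
  rewrite sE tw -[RHS]hsubmxK; congr row_mx.
  rewrite wE -mulrBr -linearB addrK linearZ /= mulrCA afx mulr1.
  by rewrite [RHS]mx11_scalar.
by exists s, w; apply: sw.
Qed.

(** Take [d] as large as possible: a form with a value outside [m] on the kernel of [t] would split
    off one more copy of [R]. *)
Lemma maximal_free_summand : fin_gen X ->
  exists d (t : {linear X -> 'rV[R]_d}) (z : {linear 'rV[R]_d -> X}),
    cancel z t /\
    forall (f : {linear X -> R^o}) x, t x = 0 -> m (f x).
Proof.
move=> /free_summand_bounded[n nP].
have free0 : exists d, `[< free_summand d >].
  by exists 0%N; apply/asboolP; exists \0, \0 => v; apply/rowP; case.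
have freen d : `[< free_summand d >] -> (d <= n)%N by move/asboolP/nP.
have [d /asboolP[t [z tz]] dmax] := ex_maxnP free0 freen.
exists d, t, z; split=> // f x tx; apply: contrapT => fx.
by have /asboolP/dmax := free_summandS tz tx fx; rewrite ltnn.
Qed.

End FreeRank.

(** * Functors on the stable category *)

Section Cokernel.
Variables (R : comNzRingType) (C : lmodType R -> Prop).
Variables (F G : stable_functor C) (e : nat_trans F G).
Implicit Types X Y Z : stable_ob C.

Definition im_pred X : {pred G X} := fun y => `[< exists x, e X x = y >].

Arguments im_pred : clear implicits.

Lemma im_pred_closed X : zmod_closed (im_pred X).
Proof.
split; first by apply/asboolP; exists 0; rewrite raddf0.
move=> _ _ /asboolP[x <-] /asboolP[y <-]; apply/asboolP.
by exists (x - y); rewrite raddfB.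
Qed.

HB.instance Definition _ X :=
  GRing.isZmodClosed.Build (G X) (im_pred X) (im_pred_closed X).

Definition coker_ob X : zmodType := {ideal_quot im_pred X}.

Definition coker_class X (y : G X) : coker_ob X :=
  \pi_({ideal_quot im_pred X})%qT y.

Definition coker_rep X (y : coker_ob X) : G X :=
  repr (y : {ideal_quot im_pred X}).

Lemma coker_repK X (y : coker_ob X) : coker_class (coker_rep y) = y.
Proof. exact: reprK. Qed.

Lemma coker_classP X (y z : G X) :
  coker_class y = coker_class z <-> exists x, e X x = y - z.
Proof.
split=> [/eqP|yz]; first by rewrite -Quotient.idealrBE => /asboolP.
by apply/eqP; rewrite -Quotient.idealrBE; apply/asboolP.
Qed.

Lemma coker_class_additive X : zmod_morphism (@coker_class X).
Proof. exact: (raddfB (\pi_({ideal_quot im_pred X})%qT)). Qed.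

HB.instance Definition _ X := GRing.isZmodMorphism.Build (G X) (coker_ob X)
  (@coker_class X) (@coker_class_additive X).

Section Map.
Variables (X Y : stable_ob C) (u : stable_hom X Y).

Definition coker_map (y : coker_ob Y) : coker_ob X :=
  coker_class (fun_map G u (coker_rep y)).

Lemma coker_mapE y : coker_map (coker_class y) = coker_class (fun_map G u y).
Proof.
apply/coker_classP; rewrite -raddfB.
have /coker_classP[x <-] := coker_repK (coker_class y).
by exists (fun_map F u x); rewrite nt_natural.
Qed.

Lemma coker_map_additive : zmod_morphism coker_map.
Proof.
move=> y z; rewrite -[y]coker_repK -[z]coker_repK -raddfB !coker_mapE.
by rewrite !raddfB.
Qed.

HB.instance Definition _ :=
  GRing.isZmodMorphism.Build _ _ coker_map coker_map_additive.
End Map.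

(** The cokernel taken object by object; it serves to show that epimorphisms of [mod_stable C] are
    surjective on each object. *)
Definition coker : stable_functor C.
Proof.
refine (@StableFunctor _ _ coker_ob (fun X Y u => coker_map u) _ _ _).
- by move=> X x; rewrite -[x]coker_repK /= coker_mapE fun_map_id.
- move=> X Y Z v u z.
  by rewrite -[z]coker_repK /= !coker_mapE fun_map_comp.
- move=> X Y u v y.
  by rewrite -[y]coker_repK /= !coker_mapE fun_map_add raddfD.
Defined.

Definition coker_pi : nat_trans G coker.
Proof.
exists (fun X => @coker_class X : {additive G X -> coker_ob X}).
by move=> X Y u y; rewrite /= coker_mapE.
Defined.

End Cokernel.

(** * Representable functors and the quasi-Frobenius hypothesis *)

Section ModStable.
Variables (R : comNzRingType) (C : lmodType R -> Prop).
Hypothesis C_sub : subcategory C.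
Implicit Types (X Y Z W : stable_ob C) (F G : stable_functor C).

Section Yoneda.
Variables (F : stable_functor C) (X : stable_ob C) (s : F X).

Section Component.
Variable Y : stable_ob C.
Definition yoneda_map (v : stable_hom Y X) : F Y := fun_map F v s.
Lemma yoneda_map_additive : zmod_morphism yoneda_map.
Proof.
move=> v w; apply: (addIr (yoneda_map w)).
by rewrite -[LHS]fun_map_add !subrK.
Qed.
HB.instance Definition _ :=
  GRing.isZmodMorphism.Build _ _ yoneda_map yoneda_map_additive.
End Component.

Definition yoneda : nat_trans (representable X) F.
Proof.
exists (fun Y => @yoneda_map Y : {additive stable_hom Y X -> F Y}).
by move=> Y Z u v; apply: fun_map_comp.
Defined.

End Yoneda.

Lemma yonedaE F X (a : nat_trans (representable X) F) Y (v : stable_hom Y X) :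
  a Y v = fun_map F v (a X (stable_id X)).
Proof. by rewrite -nt_natural /= /precomp stable_idcomp. Qed.

Lemma stable_comp0l X Y Z (u : stable_hom X Y) :
  stable_comp (0 : stable_hom Y Z) u = 0.
Proof. by apply: (addIr (stable_comp 0 u)); rewrite -stable_compDl !add0r. Qed.

Lemma stable_sum_exists X Y : exists (Z : stable_ob C)
    (i : stable_hom X Z) (j : stable_hom Y Z)
    (p : stable_hom Z X) (q : stable_hom Z Y),
  [/\ stable_comp p i = stable_id X, stable_comp q i = 0,
      stable_comp p j = 0 & stable_comp q j = stable_id Y].
Proof.
case: X Y => X CX [Y CY].
have CXY : C (X * Y)%type.
  by apply/(subcat_sum C_sub); [apply: subcat_fin_gen CX |
    apply: subcat_fin_gen CY | ].
have il : linear (fun x : X => (x, 0) : X * Y).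
  by move=> a x y; congr pair; rewrite /= scaler0 addr0.
have jl : linear (fun y : Y => (0, y) : X * Y).
  by move=> a x y; congr pair; rewrite /= scaler0 addr0.
pose p : {linear (X * Y)%type -> X} := fst.
pose q : {linear (X * Y)%type -> Y} := snd.
have class0 A B : stable_class (0 : lhom A B) = 0 :> stable_hom A B.
  by apply: (addIr (stable_class 0)); rewrite -stable_classD !add0r.
exists (StableOb CXY), (stable_class (lhom_of il)), (stable_class (lhom_of jl)),
  (stable_class (p : lhom _ _)), (stable_class (q : lhom _ _)).
by rewrite !stable_compE -!class0; split; congr stable_class; apply: lhomP.
Qed.

(** [Y0] still covers the cokernel. Its relations are those of [G], coming from [Y1], together with
    the image of [F], coming from [X0]; hence the presentation by the sum of [Y1] and [X0]. *)
Lemma coker_presented F G (e : nat_trans F G) :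
  finitely_presented F -> finitely_presented G -> finitely_presented (coker e).
Proof.
move=> [X1 [X0 [a [b bP]]]] [Y1 [Y0 [c [d dP]]]].
(* By Yoneda, [t] represents a lift of [e] to the covers [X0] and [Y0]. *)
have [t tE] := (dP X0).2 (e X0 (b X0 (stable_id X0))).
have dt W (v : stable_hom W X0) : d W (stable_comp t v) = e W (b W v).
  by rewrite [b W v]yonedaE nt_natural -tE -nt_natural.
have [Z [i [j [p [q [pi qi pj qj]]]]]] := stable_sum_exists Y1 X0.
exists Z, Y0, (nt_add (nt_comp c (yoneda (F := representable Y1) p))
  (nt_comp (yoneda (F := representable Y0) t)
    (yoneda (F := representable X0) q))).
exists (nt_comp (coker_pi e) d) => W; split; last first.
  move=> y; have [w wE] := (dP W).2 (coker_rep y).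
  by exists w; rewrite /= wE coker_repK.
move=> w; split=> [|[v <-]].
  rewrite /= -(raddf0 (@coker_class _ _ _ _ e W)) => /coker_classP[x].
  rewrite subr0; have [v <-] := (bP W).2 x; rewrite -dt => dE.
  have /(dP W).1[u uE] : d W (w - stable_comp t v) = 0.
    by rewrite raddfB -dE subrr.
  exists (stable_comp i u + stable_comp j v).
  have pE : stable_comp p (stable_comp i u + stable_comp j v) = u.
    rewrite stable_compDr !stable_compA pi pj.
    by rewrite stable_idcomp stable_comp0l addr0.
  have qE : stable_comp q (stable_comp i u + stable_comp j v) = v.
    rewrite stable_compDr !stable_compA qi qj.
    by rewrite stable_idcomp stable_comp0l add0r.
  by rewrite /= /yoneda_map /= /precomp pE qE uE subrK.
rewrite -(raddf0 (@coker_class _ _ _ _ e W)); apply/coker_classP.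
exists (b W (stable_comp q v)); rewrite subr0 raddfD -dt /=.
by rewrite (_ : d W (c W _) = 0) ?add0r //; apply/(dP W).1; eexists.
Qed.

Lemma representable_presented X : finitely_presented (representable X).
Proof.
exists X, X, (nt_zero _ _), (nt_id _) => Y; split=> [v|v]; last by exists v.
by split=> [vE|[_ <-] //]; exists 0.
Qed.

(** The pointwise cokernel is finitely presented, hence an object of the category; its projection
    and the zero map agree after [e], so they are equal. *)
Lemma epi_surjective (F G : mod_stable C) (e : Defs.hom F G) :
  epi e -> forall X, surjective (nt_app e X).
Proof.
move=> e_epi X y.
pose D : mod_stable C :=
  FPFunctor (coker_presented e (fp_presented F) (fp_presented G)).
have /e_epi E : Defs.comp (coker_pi e : Defs.hom G D) e =
    Defs.comp (hzero : Defs.hom G D) e.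
  apply: nat_transP => Z z /=; rewrite -(raddf0 (@coker_class _ _ _ _ e Z)).
  by apply/coker_classP; exists z; rewrite subr0.
have /= := congr1 (fun n : nat_trans G D => n X y) E.
rewrite -(raddf0 (@coker_class _ _ _ _ e X)) => /coker_classP[x].
by rewrite subr0; exists x.
Qed.

Definition representable_object X : mod_stable C :=
  FPFunctor (representable_presented X).

Lemma representable_projective X : projective_object (representable_object X).
Proof.
move=> F G e f /epi_surjective/(_ X (nt_app f X (stable_id X)))[x xE].
exists (yoneda x); apply: nat_transP => Y v.
by rewrite /= /yoneda_map nt_natural xE -yonedaE.
Qed.

(** The transformation induced by [g] is a monomorphism whose source is projective, hence injective.
    The identity therefore extends along it, and Yoneda turns the extension into [r]. *)
Lemma stable_mono_retraction X Y (g : stable_hom Y X) :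
  quasi_frobenius (mod_stable C) ->
  (forall W (v : stable_hom W Y), stable_comp g v = 0 -> v = 0) ->
  exists r : stable_hom X Y, stable_comp r g = stable_id Y.
Proof.
move=> [_ _ qF] g_inj.
pose h : nat_trans (representable Y) (representable X) :=
  yoneda (F := representable X) g.
have h_mono : @mono (mod_stable C) (representable_object Y)
    (representable_object X) h.
  move=> F a b ab; apply: nat_transP => W x.
  apply/eqP; rewrite -subr_eq0; apply/eqP/g_inj.
  have E : h W (nt_app a W x) = h W (nt_app b W x).
    exact: (congr1 (fun n : nat_trans F (representable X) => n W x) ab).
  by rewrite -[LHS]/(h W (_ - _)) raddfB E subrr.
have [s sE] := qF _ (@representable_projective Y) _ _ _ (idm _) h_mono.
exists (nt_app s X (stable_id X)).
have /= := congr1 (fun n : nat_trans (representable Y) (representable Y) =>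
  n Y (stable_id Y)) sE.
by rewrite /yoneda_map /= /precomp stable_compid yonedaE.
Qed.

End ModStable.

(** * Extensions by R *)

Section Extensions.
Variables (R : comNzRingType) (m : R -> Prop) (C : lmodType R -> Prop).
Hypotheses (mL : local_with m) (C_res : resolving C).
Hypothesis C_qF : quasi_frobenius (mod_stable C).
Implicit Types A K X Y : lmodType R.

Let C_sub : subcategory C := resolving_subcategory C_res.

Lemma resolving_middle A Y X (f : {linear A -> Y}) (g : {linear Y -> X}) :
  short_exact f g -> C A -> C X -> C Y.
Proof.
move=> fg CA CX.
have [Afg Xfg] := (subcat_fin_gen C_sub CA, subcat_fin_gen C_sub CX).
by apply: (resolving_extension C_res _ _ _ fg) => //;
  apply: (fin_gen_short_exact fg).
Qed.

Lemma resolving_regular : C R^o.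
Proof.
by apply: (subcat_projective C_sub); [apply: fin_gen_regular |
  apply: projective_regular].
Qed.

Lemma stable_retraction X Y (i : {linear R^o -> Y}) (g : {linear Y -> X}) :
  short_exact i g -> C X ->
  exists (r : {linear X -> Y}) n (a : {linear Y -> 'rV[R]_n})
      (b : {linear 'rV[R]_n -> Y}), forall y, y = r (g y) + b (a y).
Proof.
move=> ig CX; have CY := resolving_middle ig resolving_regular CX.
have [i_inj i_ker gs] := ig.
pose SX := StableOb CX; pose SY := StableOb CY.
(* If [g f] factors through a projective [P], lift [P -> X] to [Y]. The difference between [f] and
   the lifted composite lands in [R], so [f] factors through a projective as well. *)
have g_inj (W : stable_ob C) (v : stable_hom W SY) :
    stable_comp (stable_class (g : lhom SY SX)) v = 0 -> v = 0.
  have class0 A B : 0 = stable_class (0 : lhom A B) :> stable_hom A B.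
    by apply: (addIr (stable_class 0)); rewrite -stable_classD !add0r.
  rewrite -[v]stable_repK stable_compE !class0 => /stable_classP.
  case=> P [a [b [P_proj gv]]]; apply/stable_classP; rewrite subr0.
  set f := stable_rep v in gv *.
  have [b' b'E] := P_proj _ _ g b gs.
  pose ba := lcomp (b' : lhom P Y) a.
  have [x|c cE] := factor_injective (f := (f - ba : lhom W Y)) i_inj.
    apply/i_ker.
    have := congr1 (fun k : lhom W X => (k : {linear W -> X}) x) gv.
    by rewrite /= subr0 linearB b'E => ->; rewrite subrr.
  have -> : f = lcomp (i : lhom _ _) c + ba.
    by apply: lhomP => x; rewrite /= cE /= subrK.
  suff : lcomp (i : lhom _ _) c + ba \in stable_ideal W Y by move/asboolP.
  apply: rpredD; apply/asboolP; last by exists P, a, b'.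
  by exists R^o, c, i; split; first exact: projective_regular.
have [r0 r0E] := stable_mono_retraction C_sub C_qF g_inj.
pose r : {linear X -> Y} := stable_rep r0.
have /stable_classP[P [a [b [P_proj rg]]]] :
    stable_class (lid Y) = stable_class (lcomp (r : lhom X Y) (g : lhom Y X)).
  by rewrite -stable_compE stable_repK r0E.
(* [P] may fail to be finitely generated; since [b] lifts to a free cover of [Y], it can be replaced
   by a free module of finite rank. *)
have [n [p ps]] := fin_gen_cover (subcat_fin_gen C_sub CY).
have [b1 b1E] := P_proj _ _ p b ps.
exists r, n, (b1 \o (a : {linear Y -> P})), p => y; rewrite /= b1E addrC.
apply/eqP; rewrite -subr_eq; apply/eqP.
exact: (congr1 (fun k : lhom Y Y => (k : {linear Y -> Y}) y) rg).
Qed.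

(* If xi is the class of the extension and x lies in the maximal ideal, then
   x xi generates a direct summand of Ext^1(X, R) contained in m Ext^1(X, R), so
   x xi = 0 by Nakayama's lemma. *)
Lemma ideal_kills_extension X Y (i : {linear R^o -> Y}) (g : {linear Y -> X})
    (x : R) :
  short_exact i g -> C X -> m x -> exists f : {linear Y -> R^o}, f (i 1) = x.
Proof.
move=> ig CX mx; have [_ i_ker gs] := ig.
have [mulx mulxE] := regular_linear (x : R^o).
(* The class of [E] is [x] times that of [Y]. *)
have [E [j [u [q [jq ui qu _]]]]] := pushout_exists mulx ig.
have [r [n [a [b rab]]]] := stable_retraction jq CX.
have [j_inj j_ker _] := jq.
have [b1 b1E] := @projective_row R n _ _ g (q \o b) gs.
have [v|c cE] :=
  factor_injective (f := (b \- (u \o b1)) : {linear _ -> _}) j_inj.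
  by apply/j_ker; rewrite linearB /= qu b1E subrr.
have bE v : b v = u (b1 v) + j (c v) by rewrite cE /= addrC subrK.
have q0 : q (j 1) = 0 by apply/j_ker; exists 1.
(* As [b w = j 1] is killed by [q], [b1 w] comes from some [d] in [R]; comparing the two expressions
   of [b w] gives [c w = 1 - d * x], a unit. *)
pose w := a (j 1).
have bw : b w = j 1 by rewrite [RHS]rab q0 linear0 add0r.
have /i_ker[d dE] : g (b1 w) = 0 by rewrite b1E /= bw.
have cw : c w = 1 - d * x.
  apply: j_inj; rewrite linearB cE /= bw -dE ui mulxE.
  by congr (_ - j _).
have [e eE] : exists e, e * (1 - d * x) = 1.
  by apply: (local_unit_1B mL); case: mL => [[[_ _ mM] _ _] _]; apply: mM.
have auw : a (u (i 1)) = x *: w by rewrite ui mulxE scale1r regularE linearZ.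
(* Before scaling, the form takes the value [x * (1 - d * x)] at [i 1]. *)
exists (e \*: (c \o a \o u)).
by rewrite /= auw linearZ /= cw -[RHS]mulr1 -[X in _ = _ * X]eE; apply: mulrCA.
Qed.

Lemma new_free_summand X Y (i : {linear R^o -> Y}) (g : {linear Y -> X}) :
  short_exact i g -> C X -> exists (f : {linear Y -> R^o}) y,
    f y = 1 /\ forall t : {linear X -> R^o}, m (t (g y)).
Proof.
move=> ig CX; have [i_inj i_ker gs] := ig.
have [r [n [a [b rab]]]] := stable_retraction ig CX.
have [d [t [z [tz tP]]]] := maximal_free_summand mL (subcat_fin_gen C_sub CX).
have [z' z'E] := @projective_row R d _ _ g z gs.
(* [h] lifts to [Y] the projection of [X] onto its maximal free summand, so [g (y - h y)] lies in
   the kernel of [t], where every form takes values in [m]. *)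
pose h := z' \o t \o g.
pose a' := a \- (a \o h).
have th y : t (g (y - h y)) = 0 by rewrite linearB /= z'E linearB tz subrr.
have a'E y : a' y = a (y - h y) by rewrite linearB.
have [[y [k nm]]|am] := pselect (exists y k, ~ m (a' y 0 k)).
  have [c cE] := local_unit mL nm.
  have fl : linear (fun y => c * a y 0 k : R^o).
    by move=> e v w; rewrite linearP !mxE mulrDr mulrCA.
  have [f fE] := linear_fun fl.
  exists f, (y - h y); rewrite fE -a'E; split=> // s.
  exact: tP.
have {}am y k : m (a' y 0 k) by apply: contrapT => nm; apply: am; exists y, k.
have g0 : g (i 1) = 0 by apply/i_ker; exists 1.
have h0 : h (i 1) = 0 by rewrite /h /= g0 linear0 linear0.
have ab : b (a' (i 1)) = i 1.
  by rewrite a'E h0 subr0 [RHS]rab g0 linear0 add0r.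
(* Since [b (a' (i 1)) = i 1], this row is fixed by the matrix of [a' \o b], whose entries lie in
   [m]. *)
have a0 : a' (i 1) = 0.
  apply: (fixed_row_eq0 (N := lin1_mx (a' \o b)) mL).
    by move=> k l; rewrite mxE; apply: am.
  by rewrite mul_rV_lin1; congr (a' _).
have /i_inj/eqP : i 1 = i 0 by rewrite -ab a0 !linear0.
by rewrite oner_eq0.
Qed.

Lemma extension_splits X Y (i : {linear R^o -> Y}) (g : {linear Y -> X}) :
  short_exact i g -> C X -> exists f : {linear Y -> R^o}, f (i 1) = 1.
Proof.
move=> ig CX; have [i_inj i_ker gs] := ig.
have unit_split (f : {linear Y -> R^o}) : ~ m (f (i 1)) ->
    exists f : {linear Y -> R^o}, f (i 1) = 1.
  by move=> /(local_unit mL)[c cE]; exists (c \*: f).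
have [f [y [fy tgy]]] := new_free_summand ig CX.
have [mfi|/unit_split//] := pselect (m (f (i 1))).
have [ry ryE] := regular_linear y.
have [E [iE [uE [qE [[iE_inj iE_ker _] uEi quE E_univ]]]]] :=
  pushout_exists ry ig.
have [W [iW [uW [qW [iqW uWi quW _]]]]] := pushout_exists (g \o ry) ig.
have CW : C W := resolving_middle iqW CX CX.
have [iW_inj iW_ker _] := iqW.
(* [p] is the identity on the quotient [X] and [g] on the submodule, so its kernel is that of [g], a
   copy of [R]. *)
have [p [pu pi]] := E_univ _ uW (iW \o g) uWi.
have E_split e : exists v d, e = uE v + iE d.
  have [v vE] := gs (qE e).
  have /iE_ker[d dE] : qE (e - uE v) = 0 by rewrite linearB quE vE subrr.
  by exists v, d; rewrite dE addrC subrK.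
have jp : short_exact (iE \o i) p.
  split=> [|e|w]; first exact: inj_comp.
    split=> [|[c <-]]; last first.
      rewrite /= pi /=; suff -> : g (i c) = 0 by rewrite linear0.
      by apply/i_ker; exists c.
    have [v [d ->]] := E_split e; rewrite linearD pu pi /= => pe0.
    (* Here [uW v] is the opposite of [iW (g d)], which [qW] kills. *)
    have /i_ker[c cE] : g v = 0.
      rewrite -quW -(addrK (iW (g d)) (uW v)) pe0 sub0r linearN.
      by rewrite (iW_ker _).2 ?oppr0 //; eexists.
    have /i_ker[c' c'E] : g (ry c + d) = 0.
      by apply: iW_inj; rewrite linear0 !linearD -[iW (g (ry c))]uWi cE.
    by exists c'; rewrite /= c'E linearD -uEi cE.
  have [v vE] := gs (qW w).
  have /iW_ker[x xE] : qW (w - uW v) = 0 by rewrite linearB quW vE subrr.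
  have [d dE] := gs x.
  by exists (uE v + iE d); rewrite linearD pu pi /= dE xE addrC subrK.
have [F FE] := ideal_kills_extension jp CW mfi.
pose b := F \o iE.
(* [f] and [F \o iE] agree at [i 1], so they differ by a form [t] on [X]. As [f y = 1] and [t (g y)]
   lies in [m], [b y] is a unit. *)
have [v /i_ker[c <-]|t tE] :=
  factor_surjective (f := (f \- b : {linear _ -> _})) gs.
  have -> : i c = c *: i 1 by apply: regularE.
  by rewrite linearZ /= -FE subrr scaler0.
have by_unit : ~ m (b y).
  have [[[_ mD _] m1 _] _] := mL.
  move=> mb; apply: m1; rewrite -fy -(subrK (b y) (f y)) -[f y - _]tE.
  exact: mD.
(* The pushout square identifies [uE (i 1)] with [iE y]. *)
apply: (unit_split (F \o uE)).
by rewrite /= uEi ryE scale1r.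
Qed.

(** This is the vanishing of the connecting map into [Ext^1(X, R)]: the pushout along [f] splits,
    and the splitting restricted to [Y] extends [f]. *)
Lemma extend_to_cover K Y X (k : {linear K -> Y}) (p : {linear Y -> X})
    (f : {linear K -> R^o}) :
  short_exact k p -> C X ->
  exists h : {linear Y -> R^o}, forall x, h (k x) = f x.
Proof.
move=> kp CX.
have [E [i [u [q [iq uk _ _]]]]] := pushout_exists f kp.
have [h h1] := extension_splits iq CX.
exists (h \o u) => x.
by rewrite /= uk regularE linearZ /= h1; apply: mulr1.
Qed.

End Extensions.

(** * Syzygies and free resolutions *)

Section Resolutions.
Variables (R : comNzRingType) (C : lmodType R -> Prop).
Hypotheses (R_noeth : noetherian R) (C_res : resolving C).

(** The kernel is stored as an object of [C], so that the construction can be iterated. *)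
Record syzygy (X : lmodType R) := Syzygy {
  syz_rank : nat;
  syz_cover : {linear 'rV[R]_syz_rank -> X};
  syz_ob : stable_ob C;
  syz_inj : {linear syz_ob -> 'rV[R]_syz_rank};
  syz_exact : short_exact syz_inj syz_cover
}.

Lemma syzygy_exists X : C X -> exists s : syzygy X, True.
Proof.
have C_sub := resolving_subcategory C_res.
move=> CX; have [n [p ps]] := fin_gen_cover (subcat_fin_gen C_sub CX).
have [K [k [k_inj kp]]] := kernel_exists p.
have ex : short_exact k p by split.
suff CK : C K by exists (@Syzygy X n p (StableOb CK) k ex).
have [nfg Xfg] := (fin_gen_row R n, subcat_fin_gen C_sub CX).
have Kfg := fin_gen_submodule R_noeth nfg k_inj.
apply: (resolving_kernel C_res Kfg nfg Xfg ex) CX.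
by apply: (subcat_projective C_sub nfg); apply: projective_row.
Qed.

Definition syz (X : stable_ob C) : syzygy X :=
  sval (cid (syzygy_exists (ob_in X))).

Fixpoint nth_syz (X : stable_ob C) i : stable_ob C :=
  if i is j.+1 then syz_ob (syz (nth_syz X j)) else X.

Lemma syz_kernel (X : stable_ob C) (v : 'rV[R]_(syz_rank (syz X))) :
  syz_cover (syz X) v = 0 <->
  exists w, syz_inj (syz X) (syz_cover (syz (syz_ob (syz X))) w) = v.
Proof.
have [_ ex _] := syz_exact (syz X).
have [_ _ cs] := syz_exact (syz (syz_ob (syz X))).
split=> [/ex[x <-]|[w <-]]; last by apply/ex; eexists.
by have [w <-] := cs x; exists w.
Qed.

(** The short exact sequences of the successive syzygies are spliced together. *)
Definition syz_resolution (X : stable_ob C) : proj_resolution X.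
Proof.
refine (@ProjResolution R X (fun i => 'rV[R]_(syz_rank (syz (nth_syz X i))))
  (fun i => syz_inj (syz (nth_syz X i)) \o syz_cover (syz (nth_syz X i.+1)))
  (syz_cover (syz X)) _ _ _ _).
- by move=> i; apply: projective_row.
- by case: (syz_exact (syz X)).
- exact: syz_kernel.
- move=> i v; rewrite -[X in _ <-> X]syz_kernel /=.
  have [k_inj _ _] := syz_exact (syz (nth_syz X i)).
  by split=> [E|->]; [apply: k_inj; rewrite E linear0 | rewrite linear0].
Defined.

End Resolutions.

Theorem theorem4p2 (R : comNzRingType)
    (R_noetherian : noetherian R) (R_local : henselian_local R)
    (C : lmodType R -> Prop) (C_resolving : resolving C)
    (C_qF : quasi_frobenius (mod_stable C)) :
  forall X : lmodType R, C X -> catH X.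
Proof.
move=> X CX; have [m [mL _]] := R_local.
split; first exact: (subcat_fin_gen (resolving_subcategory C_resolving)).
case=> // i _; exists (syz_resolution R_noetherian C_resolving (StableOb CX)).
move=> f f_cocycle.
set Z := nth_syz R_noetherian C_resolving (StableOb CX) i.
have [_ _ cs] := syz_exact (syz R_noetherian C_resolving
  (syz_ob (syz R_noetherian C_resolving Z))).
(* Dimension shifting in degree [i.+1]: the cocycle [f] vanishes on the kernel of the cover of the
   next syzygy of [Z], so it descends to [f'] there; extending [f'] to the cover of [Z] makes [f] a
   coboundary. *)
have [v /syz_kernel[w <-]|f' f'E] := factor_surjective (f := f) cs.
  exact: f_cocycle.
have [h hE] := extend_to_cover mL C_resolving C_qF f'
  (syz_exact (syz R_noetherian C_resolving Z)) (ob_in Z).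
by exists h => v; rewrite /= hE f'E.
Qed.
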